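(* There exist constants $0<C_1<C_2<\infty$ such that for all sufficiently small $\delta>0$, $$C_1\,\delta|\log\delta|\le\Omega_1(\log|\sin\pi x|;\delta)\le C_2\,\delta|\log\delta|.$$ Consequently, for Lebesgue almost every $\xi$, $$\lim_{N\to\infty}\frac1N\sum_{n=1}^N\log|\sin\pi(2^n\xi-\xi)|=-\log2.$$
   Context: For $f\in L^1(\mathbb R/\mathbb Z)$ (a $1$-periodic integrable function), $\Omega_1(f;\delta)=\int_0^1|f(x+\delta)-f(x)|\,dx$ denotes its $L^1$-modulus of continuity. *)

(* Defs.v *)
From HB Require Import structures.
From mathcomp Require Import all_boot all_order all_algebra.
From mathcomp Require Import all_classical all_reals all_analysis.
Set Implicit Arguments. Unset Strict Implicit. Unset Printing Implicit Defensive.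
Import Order.TTheory GRing.Theory Num.Theory.
Import numFieldNormedType.Exports.
Local Open Scope classical_set_scope.
Local Open Scope ring_scope.

(* L^1 modulus of continuity of a 1-periodic function f:
   Omega_1(f; delta) = \int_0^1 |f(x + delta) - f(x)| dx  (Lebesgue integral, value in \bar R) *)
Definition Omega1 {R : realType} (f : R -> R) (delta : R) : \bar R :=
  (\int[@lebesgue_measure R]_(x in `[0%R, 1%R]) (`|f (x + delta) - f x|)%:E)%E.

(* the function x |-> log |sin (pi x)| (ln 0 is a junk value at integers, a null set) *)
Definition logsin {R : realType} (x : R) : R := ln `|sin (pi * x)|.

(* Main.v *)
(* First part.  Writing s = |sin pi(x + delta)| and t = |sin pi x|, the bound
   |ln s - ln t| <= ln (1 + pi delta / s) + ln (1 + pi delta / t) and periodicity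
   reduce the upper estimate to int_0^1 ln (1 + A / x) dx with A of order delta,
   which is at most 4 A - A ln A.  The lower estimate only keeps x in
   [delta, 1/8], where the difference is at least cos 1 * delta / (2 x).

   Second part.  Let F x = ln |2 sin pi x|.  Factoring X^a - 1 gives the
   distribution relation sum_(j < a) F (y + b j / a) = F (a y) for b coprime to a.
   Averaging int_0^1 F (a x) F (b x) dx over the translates of x by j / a, then
   exchanging the roles of a and b, yields
     int_0^1 F (a x) F (b x) dx = (gcd (a, b)^2 / (a b)) int_0^1 F^2.
   For a = 2^m - 1, b = 2^n - 1 with m < n the factor is at most 2^-m, so the
   sums S_N of F ((2^n - 1) x) over n <= N satisfy int_0^1 S_N^2 = O(N).
   Hence sum_k int_0^1 (S_{k^2} / k^2)^2 is finite and S_{k^2} / k^2 -> 0 almost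
   everywhere.  The indices between consecutive squares are filled in by
   monotonicity, because ln |sin| <= 0. *)

Require Import Defs.
From HB Require Import structures.
From mathcomp Require Import all_boot all_order all_algebra.
From mathcomp Require Import all_classical all_reals all_analysis.
From mathcomp Require Import measurable_realfun ring lra.
From mathcomp Require complex.
Import Order.TTheory GRing.Theory Num.Theory.
Import numFieldNormedType.Exports.
Local Open Scope classical_set_scope.
Local Open Scope ring_scope.

Set Implicit Arguments. Unset Strict Implicit. Unset Printing Implicit Defensive.

Local Notation mu := lebesgue_measure.

(** * Affine and periodic changes of variables *)

(** By uniqueness of Lebesgue measure, it is enough that [q] times the pushforward gives each
    interval []a, b]] its length. *)
Lemma pushforward_lebesgue_affine (R : realType) (q c : R) (q0 : 0 < q)
    (A : set R) : measurable A ->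
  pushforward (@mu R) (fun x => q * x + c : measurableTypeR R) A =
  (q^-1%:E * @mu R A)%E.
Proof.
move=> mA.
have mphi : measurable_fun setT (fun x : R => q * x + c : measurableTypeR R).
  by apply: measurable_funD => //; exact: measurable_funM.
suff -> : @mu R A = pushforward (mscale (NngNum (ltW q0)) (@mu R))
    (fun x => q * x + c : measurableTypeR R) A.
  by rewrite /pushforward /mscale/= muleA -EFinM mulVf ?gt_eqF// mul1e.
apply: lebesgue_measure_unique => //= _ [[a b]] _ <-.
rewrite /pushforward /mscale/=.
have -> : (fun x : R => q * x + c) @^-1` `]a, b]%classic =
    `](a - c) / q, (b - c) / q]%classic.
  apply/seteqP; split => x /=; rewrite !in_itv/=;
    by rewrite ltr_pdivrMr// ler_pdivlMr// ltrBlDr lerBrDr ![x * _]mulrC.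
rewrite !lebesgue_measure_itv/= !lte_fin ltr_pM2r ?invr_gt0// ltrBlDr subrK.
case: ifPn => _; last by rewrite mule0.
rewrite -!EFinB -EFinM; congr EFin.
by field; rewrite gt_eqF.
Qed.

Lemma pushforward_lebesgue_reflect (R : realType) (c : R) (A : set R) :
  measurable A ->
  pushforward (@mu R) (fun x => c - x : measurableTypeR R) A = @mu R A.
Proof.
move=> mA.
have mphi : measurable_fun setT (fun x : R => c - x : measurableTypeR R).
  exact: measurable_funB.
apply/esym; apply: lebesgue_measure_unique => //= _ [[a b]] _ <-.
rewrite /pushforward.
have -> : (fun x : R => c - x) @^-1` `]a, b]%classic = `[c - b, c - a[%classic.
  by apply/seteqP; split => x /=; rewrite !in_itv/= => /andP[? ?];
    apply/andP; split; lra.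
rewrite !lebesgue_measure_itv/= !lte_fin.
have -> : (c - b < c - a) = (a < b) by apply/idP/idP; lra.
by case: ifP => // _; rewrite -!EFinB; congr EFin; lra.
Qed.
Lemma ge0_integral_affine (R : realType) (q c a b : R) (f : R -> \bar R) :
  0 < q -> measurable_fun setT f -> (forall x, 0 <= f x)%E ->
  (\int[@mu R]_(x in `[a, b[) f (q * x + c)%R =
   q^-1%:E * \int[@mu R]_(x in `[(q * a + c)%R, (q * b + c)%R[) f x)%E.
Proof.
move=> q0 mf f0.
pose phi (x : measurableTypeR R) : measurableTypeR R := q * x + c.
have mphi : measurable_fun setT phi.
  by apply: measurable_funD => //; exact: measurable_funM.
have -> : `[a, b[%classic = phi @^-1` `[q * a + c, q * b + c[.
  by apply/seteqP; split => x /=; rewrite !in_itv/= lerD2r ltrD2r ler_pM2l//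
    ltr_pM2l.
have qi0 : 0 <= q^-1 by rewrite invr_ge0 ltW.
rewrite -(@ge0_integral_mscale _ _ _ _ _ _ (NngNum qi0))//;
  last exact: measurable_funS mf.
transitivity (\int[pushforward (@mu R) phi]_(x in
    `[(q * a + c)%R, (q * b + c)%R[) f x)%E.
  by rewrite (ge0_integral_pushforward mphi)//; exact: measurable_funS mf.
apply: eq_measure_integral => A mA _ /=.
exact: pushforward_lebesgue_affine.
Qed.

Lemma ge0_integral_reflect (R : realType) (f : R -> \bar R) :
  measurable_fun setT f -> (forall x, 0 <= f x)%E ->
  (\int[@mu R]_(x in `[0%R, 1%R]) f (1 - x)%R =
   \int[@mu R]_(x in `[0%R, 1%R]) f x)%E.
Proof.
move=> mf f0.
pose phi (x : measurableTypeR R) : measurableTypeR R := 1 - x.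
have mphi : measurable_fun setT phi by exact: measurable_funB.
transitivity (\int[@mu R]_(x in phi @^-1` `[0%R, 1%R]) (f \o phi) x)%E.
  congr (integral _ _ _); apply/seteqP; split => x /=;
  by rewrite /phi !in_itv/= => /andP[? ?]; apply/andP; split; lra.
transitivity (\int[pushforward (@mu R) phi]_(x in `[0%R, 1%R]) f x)%E.
  by rewrite (ge0_integral_pushforward mphi)//; exact: measurable_funS mf.
apply: eq_measure_integral => A mA _ /=.
exact: pushforward_lebesgue_reflect.
Qed.

Lemma ge0_integral_itv_split (R : realType) (a b c : R) (f : R -> \bar R) :
  a <= b -> b <= c -> measurable_fun setT f -> (forall x, 0 <= f x)%E ->
  (\int[@mu R]_(x in `[a, c[) f x =
   \int[@mu R]_(x in `[a, b[) f x + \int[@mu R]_(x in `[b, c[) f x)%E.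
Proof.
move=> ab bc mf f0.
rewrite -ge0_integral_setU//.
- by congr (integral _ _ _); rewrite -itv_bndbnd_setU ?bnd_simp.
- exact: measurable_funS mf.
- apply/disj_setPS => x /= []; rewrite !in_itv/= => /andP[_ xb] /andP[bx _].
  by move: (lt_le_trans xb bx); rewrite ltxx.
Qed.

Section periodic.
Variables (R : realType) (f : R -> \bar R).
Hypotheses (mf : measurable_fun setT f) (f0 : forall x, (0 <= f x)%E).
Hypothesis f1 : forall x, f (x + 1) = f x.

Let f_nat (k : nat) x : f (x + k%:R) = f x.
Proof. by elim: k => [|k <-]; rewrite ?addr0// -natr1 addrA f1. Qed.

Let integral_shift_nat (a b : R) (k : nat) :
  (\int[@mu R]_(x in `[(a + k%:R)%R, (b + k%:R)%R[) f x =
   \int[@mu R]_(x in `[a, b[) f x)%E.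
Proof.
have := ge0_integral_affine k%:R a b ltr01 mf f0.
rewrite invr1 !mul1r mul1e => <-.
by apply: eq_integral => x _; rewrite mul1r f_nat.
Qed.

(** The translated period [[c, 1 + c[] is cut at 1, and its right piece is moved back by one period
    onto [[0, c[]. *)
Lemma ge0_integral_periodic_translate (c : R) : 0 <= c <= 1 ->
  (\int[@mu R]_(x in `[0%R, 1%R[) f (x + c)%R =
   \int[@mu R]_(x in `[0%R, 1%R[) f x)%E.
Proof.
move=> /andP[c0 c1]; have := ge0_integral_affine c 0 1 ltr01 mf f0.
rewrite mulr0 mulr1 add0r invr1 mul1e => hc.
under eq_integral do rewrite -[x in f (x + c)]mul1r.
rewrite hc (@ge0_integral_itv_split _ c 1)// ?lerDl//.
have := integral_shift_nat 0 c 1; rewrite add0r addrC => ->.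
by rewrite addeC -ge0_integral_itv_split.
Qed.

(** The dilation carries [[0, 1[] onto [q] periods, and the Jacobian [q^-1] cancels their number. *)
Lemma ge0_integral_periodic_dilate (q : nat) : (0 < q)%N ->
  (\int[@mu R]_(x in `[0%R, 1%R[) f (q%:R * x)%R =
   \int[@mu R]_(x in `[0%R, 1%R[) f x)%E.
Proof.
move=> q0; have qR : (0 : R) < q%:R by rewrite ltr0n.
have := ge0_integral_affine 0 0 1 qR mf f0.
rewrite mulr0 mulr1 add0r addr0 => hq.
under eq_integral do rewrite -[x in f x]addr0.
rewrite hq.
have -> : (\int[@mu R]_(x in `[0%R, q%:R[) f x =
    q%:R%:E * \int[@mu R]_(x in `[0%R, 1%R[) f x)%E.
  elim: (q) => [|k IH]; first by rewrite set_itvco0 integral_set0 mul0e.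
  rewrite (@ge0_integral_itv_split _ 0 k%:R)// ?ler0n ?ler_nat// IH.
  have := integral_shift_nat 0 1 k; rewrite add0r -(natr1 k) addrC => ->.
  by rewrite EFinD ge0_muleDl ?lee_fin// mul1e.
by rewrite muleA -EFinM mulVf ?gt_eqF// mul1e.
Qed.

End periodic.

Section periodic_signed.
Variables (R : realType) (f : R -> \bar R).
Hypothesis mf : measurable_fun setT f.
Hypothesis f1 : forall x, f (x + 1) = f x.

Let mfp : measurable_fun setT f^\+%E.
Proof. exact: measurable_funepos. Qed.

Let mfn : measurable_fun setT f^\-%E.
Proof. exact: measurable_funeneg. Qed.

Let fp1 x : (f^\+ (x + 1)%R = f^\+ x)%E.
Proof. by rewrite !funeposE f1. Qed.

Let fn1 x : (f^\- (x + 1)%R = f^\- x)%E.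
Proof. by rewrite !funenegE f1. Qed.

Lemma integral_periodic_translate (c : R) : 0 <= c <= 1 ->
  (\int[@mu R]_(x in `[0%R, 1%R[) f (x + c)%R =
   \int[@mu R]_(x in `[0%R, 1%R[) f x)%E.
Proof.
move=> c01; rewrite [LHS]integralE [RHS]integralE; congr (_ - _)%E.
- rewrite -(ge0_integral_periodic_translate mfp _ fp1 c01)//.
  by apply: eq_integral => x _; rewrite !funeposE.
- rewrite -(ge0_integral_periodic_translate mfn _ fn1 c01)//.
  by apply: eq_integral => x _; rewrite !funenegE.
Qed.

Lemma integral_periodic_dilate (q : nat) : (0 < q)%N ->
  (\int[@mu R]_(x in `[0%R, 1%R[) f (q%:R * x)%R =
   \int[@mu R]_(x in `[0%R, 1%R[) f x)%E.
Proof.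
move=> q0; rewrite [LHS]integralE [RHS]integralE; congr (_ - _)%E.
- rewrite -(ge0_integral_periodic_dilate mfp _ fp1 q0)//.
  by apply: eq_integral => x _; rewrite !funeposE.
- rewrite -(ge0_integral_periodic_dilate mfn _ fn1 q0)//.
  by apply: eq_integral => x _; rewrite !funenegE.
Qed.

End periodic_signed.
(** * The distribution relation for the sine *)

Section distribution_relation.
Variable R : realType.
Implicit Types x y : R.

Lemma sin_pi_intDr x (k : int) : `|sin (pi * (x + k%:~R))| = `|sin (pi * x)|.
Proof.
have nat_case (n : nat) (z : R) : `|sin (pi * (z + n%:R))| = `|sin (pi * z)|.
  elim: n => [|n <-]; first by rewrite addr0.
  by rewrite -natr1 addrA mulrDr mulr1 sinDpi normrN.
case: (intP k) => [|n|n]; first by rewrite addr0.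
  exact: nat_case.
by rewrite -(nat_case n.+1) mulrNz subrK.
Qed.

(** The sine also vanishes at the fractional part [r] of [x], and it is positive on the open
    interval from 0 to [pi], so [r] is 0. *)
Lemma sin_pi_eq0 x : sin (pi * x) = 0 -> exists k : int, x = k%:~R.
Proof.
move=> s0; exists (Num.floor x).
have [x_le x_lt] := (floor_le_tmp x, floorD1_gt x).
pose r := x - (Num.floor x)%:~R.
have : `|sin (pi * r)| = 0 by rewrite /r -mulrNz sin_pi_intDr s0 normr0.
move=> /normr0P/eqP sr; apply/eqP; rewrite -subr_eq0 -/r; apply/eqP.
have r0 : 0 <= r by rewrite subr_ge0.
have r1 : r < 1 by rewrite ltrBlDr addrC -intrD1.
apply/eqP; case: (ltgtP r 0) r0 => // r_gt0 _.
suff : 0 < sin (pi * r) by rewrite sr ltxx.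
by rewrite sin_gt0_pi// mulr_gt0 ?pi_gt0//= gtr_pMr ?pi_gt0.
Qed.

Import complex Normc.

(** The point [exp (2 pi i x)] of the unit circle. *)
Let cis x : R[i] := (cos (2 * pi * x) +i* sin (2 * pi * x))%C.

Let cisD x y : cis (x + y) = cis x * cis y.
Proof.
rewrite /cis mulrDr cosD sinD; apply/eqP; rewrite eq_complex/=.
by apply/andP; split; apply/eqP; ring.
Qed.

Let cis0 : cis 0 = 1.
Proof. by rewrite /cis mulr0 cos0 sin0. Qed.

Let cisX x n : cis x ^+ n = cis (n%:R * x).
Proof.
elim: n => [|n IH]; first by rewrite mul0r cis0 expr0.
by rewrite exprS IH -cisD -natr1 mulrDl mul1r addrC.
Qed.

(** Chord length on the unit circle: its square is [2 - 2 cos (2 pi (x - y))], which the double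
    angle formula turns into [4 sin^2]. *)
Let normc_cisB x y : normc (cis x - cis y) = 2 * `|sin (pi * (x - y))|.
Proof.
rewrite /cis /=.
have -> : (cos (2 * pi * x) - cos (2 * pi * y)) ^+ 2 +
   (sin (2 * pi * x) - sin (2 * pi * y)) ^+ 2 = (2 * sin (pi * (x - y))) ^+ 2.
  have h1 := cos2Dsin2 (2 * pi * x); have h2 := cos2Dsin2 (2 * pi * y).
  have : cos (2 * pi * x - 2 * pi * y) = 1 - 2 * sin (pi * (x - y)) ^+ 2.
    have -> : 2 * pi * x - 2 * pi * y = (pi * (x - y)) *+ 2 by ring.
    rewrite cos_mulr2n cos2sin2; ring.
  rewrite cosB => h3; set cx := cos _ in h1 h3 *; set sx := sin _ in h1 h3 *.
  set cy := cos _ in h2 h3 *; set sy := sin _ in h2 h3 *.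
  transitivity (cx ^+ 2 + sx ^+ 2 + (cy ^+ 2 + sy ^+ 2) -
    2 * (cx * cy + sx * sy)); first by ring.
  by rewrite h1 h2 h3; ring.
by rewrite sqrtr_sqr normrM ger0_norm.
Qed.

(** If the [m]-th power is 1, then [m b / a] is an integer, so [a] divides [m b] and, by
    coprimality, [m]. The minus sign makes the distance from [cis y] to the [j]-th power equal
    [2 |sin pi (y + b j / a)|]. *)
Let cis_prim_root (a b : nat) : (0 < a)%N -> coprime a b ->
  a.-primitive_root (cis (- (b%:R / a%:R))).
Proof.
move=> a0 ab; set z := cis _.
have aR : a%:R != 0 :> R by rewrite pnatr_eq0 -lt0n.
have zX (m : nat) : z ^+ m = 1 -> (a %| m)%N.
  move=> zm; have /sin_pi_eq0[k hk] :
      sin (pi * (m%:R * (- (b%:R / a%:R)) - 0)) = 0 :> R.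
    apply/eqP; rewrite -normr_eq0; apply/eqP/(@mulfI _ 2) => //.
    by rewrite mulr0 -normc_cisB -cisX zm cis0 subrr /= expr0n/= addr0 sqrtr0.
  have : (m%:R * b%:R : R) = (- k)%:~R * a%:R.
    by rewrite mulrNz -hk; field.
  rewrite -natrM [(m * b)%:R]pmulrn [a%:R]pmulrn -intrM => /eqP.
  rewrite eqr_int => /eqP hmk.
  rewrite -(Gauss_dvdl _ ab).
  have : (Posz a %| Posz (m * b))%Z by rewrite hmk dvdz_mull.
  by rewrite dvdzE.
have za : z ^+ a = 1.
  apply/eqP; rewrite -subr_eq0; apply/eqP/eq0_normc.
  rewrite cisX -cis0 normc_cisB subr0.
  have -> : a%:R * - (b%:R / a%:R) = 0 + (- b%:Z)%:~R :> R.
    by rewrite mulrNz add0r; field.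
  by rewrite sin_pi_intDr mulr0 sin0 normr0 mulr0.
have [m prim_m ma] := prim_order_exists a0 za.
suff -> : a = m by [].
apply/eqP; rewrite eqn_dvd ma andbT; apply: zX; exact: prim_expr_order.
Qed.

(** Evaluate the factorization of [X^a - 1] over the powers of a primitive root at [cis y], and take
    moduli. *)
Lemma prod_sin_pi_shift (a b : nat) y : (0 < a)%N -> coprime a b ->
  \prod_(j < a) (2 * `|sin (pi * (y + b%:R * (j%:R / a%:R)))|) =
  2 * `|sin (pi * (a%:R * y))|.
Proof.
move=> a0 ab; have prim_z := cis_prim_root a0 ab.
have -> : 2 * `|sin (pi * (a%:R * y))| = normc (('X^a - 1).[cis y]).
  have -> : ('X^a - 1).[cis y] = cis (a%:R * y) - cis 0.
    by rewrite !hornerE cisX cis0.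
  by rewrite normc_cisB subr0.
rewrite -(factor_Xn_sub_1 prim_z) horner_prod big_mkord.
rewrite (big_morph _ (@normcM R) (@normc1 R)).
apply: eq_bigr => j _; rewrite hornerXsubC cisX normc_cisB.
by congr (2 * `|sin (pi * _)|); field; rewrite pnatr_eq0 -lt0n.
Qed.

End distribution_relation.

(** * The functions log |sin pi x| and log |2 sin pi x| *)

Section logsin_theory.
Variable R : realType.
Implicit Types x y : R.

Lemma measurable_logsin : measurable_fun setT (@logsin R).
Proof.
apply: (measurableT_comp (@measurable_ln R)).
apply: measurableT_comp; first exact: normr_measurable.
apply: continuous_measurable_fun => x.
apply: continuous_comp; last exact: continuous_sin.
exact: mulrl_continuous.
Qed.

Lemma logsinDint x (k : int) : logsin (x + k%:~R) = logsin x.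
Proof. by rewrite /logsin sin_pi_intDr. Qed.

Lemma logsin_le0 x : logsin x <= 0.
Proof. by rewrite ln_le0// sin_max. Qed.

(* This is [ln |2 sin (pi x)|], except at the integers, where it is [ln 2]. *)
Definition clogsin x := logsin x + ln 2.

Lemma measurable_clogsin : measurable_fun setT clogsin.
Proof. by apply: measurable_funD => //; exact: measurable_logsin. Qed.

Lemma clogsinDnat x (n : nat) : clogsin (x + n%:R) = clogsin x.
Proof. by rewrite /clogsin pmulrn logsinDint. Qed.

Lemma clogsinD1 x : clogsin (x + 1) = clogsin x.
Proof. exact: (clogsinDnat x 1). Qed.

Lemma clogsinE x : sin (pi * x) != 0 -> clogsin x = ln (2 * `|sin (pi * x)|).
Proof. by move=> s0; rewrite lnM ?posrE ?normr_gt0// addrC. Qed.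

Lemma ln_prod (I : Type) (s : seq I) (f : I -> R) : (forall i, 0 < f i) ->
  ln (\prod_(i <- s) f i) = \sum_(i <- s) ln (f i).
Proof.
move=> f0; elim: s => [|i s IH]; first by rewrite !big_nil ln1.
by rewrite !big_cons lnM ?posrE ?prodr_gt0// IH.
Qed.

(** The logarithm of the product formula. Since the product is nonzero, so is every factor, and the
    default value of [ln 0] never enters. *)
Lemma clogsin_shift_sum (a b : nat) y : (0 < a)%N -> coprime a b ->
  sin (pi * (a%:R * y)) != 0 ->
  \sum_(j < a) clogsin (y + b%:R * (j%:R / a%:R)) = clogsin (a%:R * y).
Proof.
move=> a0 ab s0; rewrite clogsinE// -(prod_sin_pi_shift _ a0 ab).
have sj (j : 'I_a) : sin (pi * (y + b%:R * (j%:R / a%:R))) != 0.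
  apply: contra_neq s0 => sj; apply/eqP; rewrite -normr_eq0; apply/eqP.
  apply: (@mulfI _ 2) => //; rewrite mulr0 -(prod_sin_pi_shift _ a0 ab).
  by rewrite (bigD1 j)//= sj normr0 mulr0 mul0r.
rewrite ln_prod => [|j]; last by rewrite mulr_gt0// normr_gt0.
by apply: eq_bigr => j _; rewrite clogsinE.
Qed.

(** The exceptional set is indexed by the integers, hence countable and null. *)
Lemma ae_sin_pi_neq0 (c d : R) : c != 0 ->
  {ae @mu R, forall x, sin (pi * (c * x + d)) != 0}.
Proof.
move=> c0; exists [set x | exists k : int, x = (k%:~R - d) / c].
have cnt : countable [set x | exists k : int, x = (k%:~R - d) / c].
  rewrite (_ : mkset _ = range (fun k : int => (k%:~R - d) / c)).
    exact: sub_countable (card_image_le _ _) (countableP _).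
  by apply/seteqP; split => x /= [k]; [move=> ->; exists k|move=> _ <-; exists k].
split.
- exact: countable_measurable.
- exact: countable_lebesgue_measure0.
- move=> x /= /negP/negPn/eqP/sin_pi_eq0[k hk]; exists k.
  by rewrite -hk; field.
Qed.

End logsin_theory.

(** * Integrals of inverse powers *)

Section improper.
Variable R : realType.

Lemma integral_inv_itv (a b : R) : 0 < a -> a < b ->
  (\int[@mu R]_(x in `[a, b]) (x^-1)%:E = (ln b - ln a)%:E)%E.
Proof.
move=> a0 ab; rewrite (@continuous_FTC2 _ (fun x => x^-1) (@ln R))//.
- apply: continuous_in_subspaceT => x /[!inE]/=; rewrite in_itv/= => /andP[ax _].
  by apply: continuousV; [rewrite gt_eqF//; lra|exact: cvg_id].
- split.
  + move=> x; rewrite in_itv/= => /andP[ax _].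
    have x0 : 0 < x by lra.
    by have [] := is_derive1_ln x0.
  + by apply: cvg_at_right_filter; apply: continuous_ln.
  + by apply: cvg_at_left_filter; apply: continuous_ln; lra.
- move=> x; rewrite in_itv/= => /andP[ax _].
  have x0 : 0 < x by lra.
  by rewrite derive1E; have [_ ->] := is_derive1_ln x0.
Qed.

Let integral_invsqrt_itv (a b : R) : 0 < a -> a < b ->
  (\int[@mu R]_(x in `[a, b]) ((Num.sqrt x)^-1)%:E =
    (2 * Num.sqrt b - 2 * Num.sqrt a)%:E)%E.
Proof.
move=> a0 ab.
have D (x : R) : 0 < x ->
    is_derive x 1 (fun x => 2 * Num.sqrt x) ((Num.sqrt x)^-1).
  move=> x0; have h := is_derive1_sqrt x0; have := is_deriveZ (2 : R) h.
  by rewrite /GRing.scale/= invfM mulVKf.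
have C (x : R) : 0 < x -> {for x, continuous (fun x => 2 * Num.sqrt x)}.
  move=> x0; apply: differentiable_continuous; apply/derivable1_diffP.
  by have [] := D _ x0.
rewrite (@continuous_FTC2 _ (fun x => (Num.sqrt x)^-1) (fun x => 2 * Num.sqrt x))//.
- apply: continuous_in_subspaceT => x /[!inE]/=; rewrite in_itv/= => /andP[ax _].
  apply: continuousV; last exact: sqrt_continuous.
  by rewrite gt_eqF// sqrtr_gt0; lra.
- split.
  + move=> x; rewrite in_itv/= => /andP[ax _].
    have x0 : 0 < x by lra.
    by have [] := D _ x0.
  + by apply: cvg_at_right_filter; apply: C.
  + by apply: cvg_at_left_filter; apply: C; lra.
- move=> x; rewrite in_itv/= => /andP[ax _].
  have x0 : 0 < x by lra.
  by rewrite derive1E; have [_ ->] := D _ x0.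
Qed.

Lemma measurable_inv : measurable_fun setT (fun x : R => x^-1).
Proof.
rewrite -(setUv [set (0 : R)]); apply/measurable_funU => //.
  exact: measurableC.
split; first exact: measurable_fun_set1.
apply: open_continuous_measurable_fun.
  exact: closed_openC.
by move=> x /[!inE]/= /eqP x0; apply: continuousV => //; exact: cvg_id.
Qed.

Lemma measurable_invsqrt : measurable_fun setT (fun x : R => (Num.sqrt x)^-1).
Proof.
have -> : (fun x : R => (Num.sqrt x)^-1) = (fun x => x^-1) \o Num.sqrt by [].
apply: measurableT_comp; first exact: measurable_inv.
by apply: continuous_measurable_fun; exact: sqrt_continuous.
Qed.

Lemma integral_invsqrt_le (c : R) : 0 < c ->
  (\int[@mu R]_(x in `[0%R, c]) ((Num.sqrt x)^-1)%:E <= (2 * Num.sqrt c)%:E)%E.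
Proof.
(* These intervals exhaust []0, c]], so monotone convergence applies. With [n.+2] even the first one
   is nondegenerate, as the evaluation of its integral requires. *)
move=> c0; pose F (n : nat) := `[c / n.+2%:R, c]%classic.
have mf D : measurable_fun D (fun x : R => ((Num.sqrt x)^-1)%:E).
  by apply: measurable_funTS; apply/measurable_EFinP; exact: measurable_invsqrt.
rewrite -integral_itv_obnd_cbnd//.
have -> : `]0%R, c]%classic = \bigcup_i F i.
  apply/seteqP; split => x /=; rewrite in_itv/=.
    move=> /andP[x0 xc]; exists (Num.bound (c / x)) => //=.
    rewrite /F/= in_itv/= xc andbT ler_pdivrMr// mulrC -ler_pdivrMr//.
    have : c / x < (Num.bound (c / x))%:R.
      by rewrite archi_boundP// divr_ge0// ltW.
    by move=> /ltW /le_trans; apply; rewrite ler_nat -addn2 leq_addr.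
  move=> [n _]; rewrite /F/= in_itv/= => /andP[h ->]; rewrite andbT.
  by apply: lt_le_trans h; rewrite divr_gt0.
have ndF : nondecreasing_seq F.
  move=> m n mn; apply/subsetPset => x; rewrite /F/= !in_itv/= => /andP[h ->].
  rewrite andbT; apply: le_trans h.
  by rewrite ler_pM2l// lef_pV2 ?posrE// ler_nat !ltnS.
have f0 (x : R) : (0 <= ((Num.sqrt x)^-1)%:E)%E.
  by rewrite lee_fin invr_ge0 sqrtr_ge0.
have cvgF : (\int[@mu R]_(x in F i) ((Num.sqrt x)^-1)%:E @[i --> \oo] -->
    \int[@mu R]_(x in \bigcup_i F i) ((Num.sqrt x)^-1)%:E)%E.
  apply: ge0_nondecreasing_set_cvg_integral => [//|i|i|i x _ //].
    exact: measurable_itv.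
  exact: mf.
rewrite -(cvg_lim _ cvgF)//.
apply: lime_le; first by apply/cvg_ex; eexists; exact: cvgF.
apply: nearW => n; rewrite integral_invsqrt_itv ?divr_gt0//.
  by rewrite lee_fin gerBl mulr_ge0// sqrtr_ge0.
by rewrite ltr_pdivrMr// ltr_pMr// ltr1n.
Qed.

End improper.

(** * Elementary inequalities for the sine and the logarithm *)

Section sine_bounds.
Variable R : realType.
Implicit Types a b x y : R.

Let sin_MVT a b : a < b ->
  exists2 c, a < c < b & sin b - sin a = cos c * (b - a).
Proof.
move=> ab; have [|c] := @MVT R sin cos a b ab (fun x _ => is_derive_sin x).
  by apply: continuous_subspaceT; exact: continuous_sin.
by rewrite in_itv/= => cab ->; exists c.
Qed.

Lemma sinB_le a b : `|sin a - sin b| <= `|a - b|.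
Proof.
wlog ab : a b / a < b => [H|].
  by have [/H//|/H|->] := ltgtP a b; [rewrite distrC [leRHS]distrC|rewrite !subrr].
have [c _ h] := sin_MVT ab; rewrite distrC h normrM [leRHS]distrC.
by rewrite ler_piMl// cos_max.
Qed.

Lemma sinB_ge a b : 0 <= a -> a <= b -> b <= 1 ->
  cos 1 * (b - a) <= sin b - sin a.
Proof.
move=> a0; rewrite le_eqVlt => /predU1P[<-|ab] b1; first by rewrite !subrr mulr0.
have [c /andP[ac cb] ->] := sin_MVT ab.
rewrite ler_pM2r ?subr_gt0//.
have pi2 := @pi_ge2 R; apply/ltW; rewrite ltr_cos ?in_itv/=; lra.
Qed.

(** On [[0, 1/2]] there are two regimes: while [pi x <= 1] the mean value bound has slope at least
    [cos 1]; afterwards the sine exceeds [sin 1]. The reflection of [x] to [1 - x] covers the other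
    half. *)
Lemma sin_pi_ge : exists2 k : R, 0 < k &
  forall x, 0 <= x <= 1 ->
    k * x <= `|sin (pi * x)| \/ k * (1 - x) <= `|sin (pi * x)|.
Proof.
have pi2 := @pi_ge2 R; have p1 := @pihalf_lt2 R.
have s1 : 0 < sin 1 :> R by rewrite sin_gt0_pi//; lra.
have c1 := @cos1_gt0 R.
pose k := Num.min (cos 1) (sin 1) : R.
have k0 : 0 < k by rewrite lt_min c1.
have half x : 0 <= x <= 2^-1 -> k * x <= sin (pi * x).
  move=> /andP[x0 x1]; have [px|px] := leP (pi * x) 1.
    have px0 : 0 <= pi * x by rewrite mulr_ge0// pi_ge0.
    have := sinB_ge (lexx 0) px0 px; rewrite sin0 !subr0; apply: le_trans.
    apply: ler_pM => //; [exact: ltW|by rewrite ge_min lexx|nra].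
  have : sin 1 < sin (pi * x).
    rewrite ltr_sin// in_itv/=; first lra.
    by apply/andP; split; nra.
  have : k * x <= sin 1 * x by rewrite ler_wpM2r// ge_min lexx orbT.
  nra.
exists k => // x /andP[x0 x1]; have [xh|xh] := leP x 2^-1.
  by left; apply: le_trans (ler_norm _); apply: half; rewrite x0.
right; have -> : `|sin (pi * x)| = `|sin (pi * (1 - x))|.
  rewrite -[RHS]normrN -sinN -(sin_pi_intDr x (-1)) mulrN1z.
  by congr (`|sin _|); ring.
by apply: le_trans (ler_norm _); apply: half; lra.
Qed.

(** With [y] the fourth root of [x], [ln x = 4 ln y] and [- ln y <= 1 / y]; squaring gives 16. *)
Lemma ln_sqr_le x : 0 < x -> x <= 1 -> ln x ^+ 2 <= 16 * (Num.sqrt x)^-1.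
Proof.
move=> x0 x1; pose y := Num.sqrt (Num.sqrt x).
have y0 : 0 < y by rewrite !sqrtr_gt0.
have yx : y ^+ 4 = x.
  by rewrite (exprM y 2 2) !sqr_sqrtr// ?sqrtr_ge0// ltW.
have -> : Num.sqrt x = y ^+ 2 by rewrite sqr_sqrtr ?sqrtr_ge0.
rewrite -{1}yx lnXn// -exprVn.
have hy : ln y <= 0.
  by rewrite ln_le0// -[leRHS]sqrtr1 ler_wsqrtr// -[leRHS]sqrtr1 ler_wsqrtr.
have : - ln y <= y^-1.
  by rewrite -lnV ?posrE//; apply/ltW/ln_sublinear; rewrite invr_gt0.
nra.
Qed.

(** Use [1 + x <= (1 + sqrt x)^2] and then [ln (1 + y) <= y]. *)
Lemma ln1D_le2sqrt x : 0 <= x -> ln (1 + x) <= 2 * Num.sqrt x.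
Proof.
move=> x0; set y := Num.sqrt x.
have y0 : 0 <= y by rewrite sqrtr_ge0.
have yx : y ^+ 2 = x by rewrite sqr_sqrtr.
have h1 : ln (1 + x) <= ln ((1 + y) ^+ 2).
  by rewrite ler_ln ?posrE; nra.
apply: le_trans h1 _; rewrite lnXn; last lra.
rewrite mulrC mulr_natr lerMn2r/=; apply: le_ln1Dx; lra.
Qed.

(** From [u <= v (1 + e / v)] one logarithm bounds [ln u - ln v]. Adding the other, which is
    nonnegative, makes the bound symmetric. *)
Lemma distr_ln_le x y (e : R) : 0 < x -> 0 < y -> `|x - y| <= e ->
  `|ln x - ln y| <= ln (1 + e / x) + ln (1 + e / y).
Proof.
move=> x0 y0 xy; have e0 : 0 <= e by exact: le_trans xy.
have lnD u v : 0 < u -> 0 < v -> `|u - v| <= e ->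
    ln u - ln v <= ln (1 + e / u) + ln (1 + e / v).
  move=> u0 v0; rewrite ler_norml => /andP[_ uv].
  have ev : 0 < 1 + e / v by rewrite ltr_wpDr// divr_ge0// ltW.
  have : ln u <= ln v + ln (1 + e / v).
    rewrite -lnM ?posrE// ler_ln ?posrE// ?mulr_gt0//.
    by rewrite mulrDr mulr1 mulrC divfK ?gt_eqF//; lra.
  have : 0 <= ln (1 + e / u) by rewrite ln_ge0// lerDl divr_ge0// ltW.
  lra.
rewrite ler_norml; apply/andP; split; last exact: lnD.
by rewrite lerNl opprB [leRHS]addrC; apply: lnD => //; rewrite distrC.
Qed.

End sine_bounds.

(** * The modulus of continuity and square integrability *)

Section modulus.
Variable R : realType.
Local Notation I := (`[(0 : R), 1]%classic).

(** Serves majorants with a singularity at each end of the unit interval. *)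
Lemma ge0_integral_symmetrize (h : R -> R) :
  measurable_fun setT h -> (forall x, 0 <= h x) ->
  (\int[@mu R]_(x in I) (h x + h (1 - x))%:E =
   2%:E * \int[@mu R]_(x in I) (h x)%:E)%E.
Proof.
move=> mh h0.
have mEh : measurable_fun setT (EFin \o h) by exact/measurable_EFinP.
have mh' : measurable_fun setT (fun x : R => h (1 - x)).
  by apply: measurableT_comp => //; exact: measurable_funB.
under eq_integral do rewrite EFinD.
rewrite ge0_integralD//=; last 4 first.
- by move=> x _; rewrite lee_fin.
- exact: measurable_funTS.
- by move=> x _; rewrite lee_fin.
- by apply/measurable_funTS/measurable_EFinP.
rewrite (ge0_integral_reflect mEh)//=.
have -> : (2%:E = 1%:E + 1%:E :> \bar R)%E by rewrite -EFinD.
by rewrite ge0_muleDl ?lee_fin// mul1e.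
Qed.

Lemma integral_co_cc (h : R -> \bar R) : measurable_fun setT h ->
  (\int[@mu R]_(x in `[0%R, 1%R[) h x = \int[@mu R]_(x in I) h x)%E.
Proof.
by move=> mh; rewrite integral_itv_bndo_bndc//; exact: measurable_funTS.
Qed.

Lemma clogsin_sqr_integrable :
  (\int[@mu R]_(x in `[0%R, 1%R[) (clogsin x ^+ 2)%:E < +oo)%E.
Proof.
have [k k0 sin_ge] := sin_pi_ge R.
(* From [(ln s + ln 2)^2 <= 2 ln^2 s + 2 ln^2 2]: 32 is twice the constant of [ln_sqr_le], and [g x]
   and [g (1 - x)] each carry one [ln^2 2]. *)
pose g (x : R) := 32 / Num.sqrt k * (Num.sqrt x)^-1 + ln 2 ^+ 2.
have g0 x : 0 <= g x.
  by rewrite addr_ge0 ?sqr_ge0// mulr_ge0 ?divr_ge0 ?invr_ge0 ?sqrtr_ge0.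
have mg : measurable_fun setT g.
  apply: measurable_funD => //; apply: measurable_funM => //.
  exact: measurable_invsqrt.
have gk (x s : R) : 0 < s -> s <= 1 -> k * x <= s -> 0 < x ->
    32 * (Num.sqrt s)^-1 + ln 2 ^+ 2 <= g x.
  move=> s0 s1 kxs x0; rewrite /g lerD2r -mulrA ler_pM2l// -invfM.
  rewrite -sqrtrM; last exact: ltW.
  by rewrite lef_pV2 ?posrE ?sqrtr_gt0 ?mulr_gt0// ler_wsqrtr.
have bound x : 0 <= x < 1 -> clogsin x ^+ 2 <= g x + g (1 - x).
  move=> /andP[x0 x1]; rewrite /clogsin /logsin; set s := `|_|.
  have [s0|s0] := eqVneq s 0.
    rewrite s0 ln0// add0r.
    have : ln 2 ^+ 2 <= g x.
      by rewrite lerDr mulr_ge0 ?divr_ge0 ?invr_ge0 ?sqrtr_ge0.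
    have := g0 (1 - x); lra.
  have {}s0 : 0 < s by rewrite lt_neqAle eq_sym s0 normr_ge0.
  have s1 : s <= 1 by exact: sin_max.
  have x_gt0 : 0 < x.
    rewrite lt_neqAle x0 andbT; apply/eqP => x00.
    by move: s0; rewrite /s -x00 mulr0 sin0 normr0 ltxx.
  have h1 : (ln s + ln 2) ^+ 2 <= 2 * ln s ^+ 2 + 2 * ln 2 ^+ 2.
    by have := sqr_ge0 (ln s - ln 2); nra.
  have h2 := ln_sqr_le s0 s1.
  have h3 : ln 2 ^+ 2 <= g x /\ ln 2 ^+ 2 <= g (1 - x).
    by split; rewrite lerDr mulr_ge0 ?divr_ge0 ?invr_ge0 ?sqrtr_ge0.
  have [|kx|kx] := sin_ge x.
  - by rewrite x0 ltW.
  - by have := gk _ _ s0 s1 kx x_gt0; lra.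
  - have x1' : 0 < 1 - x by lra.
    by have := gk _ _ s0 s1 kx x1'; lra.
have mgg : measurable_fun setT (fun x : R => g x + g (1 - x)).
  apply: measurable_funD => //.
  by apply: measurableT_comp => //; exact: measurable_funB.
apply: (@le_lt_trans _ _
    (\int[@mu R]_(x in `[0%R, 1%R[) (g x + g (1 - x)%R)%:E)%E).
  apply: ge0_le_integral => //=.
  - by move=> x _; rewrite lee_fin sqr_ge0.
  - apply/measurable_funTS/measurable_EFinP/measurable_funX.
    exact: measurable_clogsin.
  - by apply/measurable_funTS/measurable_EFinP.
rewrite integral_co_cc; last exact/measurable_EFinP.
rewrite ge0_integral_symmetrize// lte_mul_pinfty//.
under eq_integral do rewrite /g EFinD EFinM.
rewrite ge0_integralD//=; last 2 first.
- apply/measurable_funTS/measurable_EFinP; apply: measurable_funM => //.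
  exact: measurable_invsqrt.
- by move=> x _; rewrite lee_fin sqr_ge0.
rewrite lte_add_pinfty//.
  rewrite ge0_integralZl_EFin//=.
  - rewrite lte_mul_pinfty// ?lee_fin ?divr_ge0 ?sqrtr_ge0//.
    by apply: le_lt_trans (integral_invsqrt_le ltr01) _; rewrite ltry.
  - by apply/measurable_funTS/measurable_EFinP; exact: measurable_invsqrt.
by rewrite integral_cst//= lebesgue_measure_itv/= lte_fin ltr01 -EFinB -EFinM ltry.
Qed.

(** Cut at [A]. Below, [ln (1 + A / x) <= 2 sqrt (A / x)] contributes at most [4 A]; above,
    [ln (1 + A / x) <= A / x] contributes at most [- A ln A]. *)
Lemma integral_ln1D_inv_le (A : R) : 0 < A -> A < 1 ->
  (\int[@mu R]_(x in I) (ln (1 + A / `|x|))%:E <= (4 * A - A * ln A)%:E)%E.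
Proof.
move=> A0 A1; pose h (x : R) := ln (1 + A / `|x|).
have h0 x : 0 <= h x.
  by rewrite ln_ge0// lerDl divr_ge0// ltW.
have mh : measurable_fun setT (EFin \o h).
  apply/measurable_EFinP; apply: (measurableT_comp (@measurable_ln R)).
  apply: measurable_funD => //; apply: measurable_funM => //.
  exact: (measurableT_comp (@measurable_inv R) (@normr_measurable R setT)).
rewrite -integral_co_cc// (@ge0_integral_itv_split _ 0 A 1)//; [|exact: ltW..].
have -> : 4 * A - A * ln A = 2 * Num.sqrt A * (2 * Num.sqrt A) + A * (ln 1 - ln A).
  by rewrite ln1 -{1}(sqr_sqrtr (ltW A0)); ring.
rewrite EFinD; apply: leeD.
- rewrite integral_itv_bndo_bndc; last exact: measurable_funTS.
  apply: (@le_trans _ _ (\int[@mu R]_(x in `[0%R, A])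
      ((2 * Num.sqrt A)%:E * ((Num.sqrt x)^-1)%:E))%E).
    apply: ge0_le_integral => //=.
    + by move=> x _; rewrite lee_fin; exact: h0.
    + exact: measurable_funTS.
    + apply/measurable_funTS/measurable_EFinP; apply: measurable_funM => //.
      exact: measurable_invsqrt.
    + move=> x; rewrite in_itv/= lee_fin => /andP[x0 _].
      rewrite /h (ger0_norm x0).
      apply: (le_trans (ln1D_le2sqrt _)); first by rewrite divr_ge0// ltW.
      by rewrite sqrtrM ?(ltW A0)// sqrtrV// mulrA.
  rewrite ge0_integralZl_EFin//=.
  + rewrite [in leRHS]EFinM; apply: lee_wpmul2l; last exact: integral_invsqrt_le.
    by rewrite lee_fin mulr_ge0// sqrtr_ge0.
  + by apply/measurable_funTS/measurable_EFinP; exact: measurable_invsqrt.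
- rewrite integral_itv_bndo_bndc; last exact: measurable_funTS.
  apply: (@le_trans _ _ (\int[@mu R]_(x in `[A, 1%R]) (A%:E * (x^-1)%:E))%E).
    apply: ge0_le_integral => //=.
    + by move=> x _; rewrite lee_fin; exact: h0.
    + exact: measurable_funTS.
    + apply/measurable_funTS/measurable_EFinP; apply: measurable_funM => //.
      exact: measurable_inv.
    + move=> x; rewrite in_itv/= lee_fin => /andP[Ax _].
      have x0 : 0 < x by lra.
      rewrite /h (gtr0_norm x0); apply: le_ln1Dx.
      by rewrite (@lt_le_trans _ _ 0)// divr_ge0// ltW.
  rewrite ge0_integralZl_EFin//=.
  + by rewrite (integral_inv_itv A0 A1) EFinM.
  + by move=> x; rewrite in_itv/= lee_fin invr_ge0 => /andP[Ax _]; lra.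
  + by apply/measurable_funTS/measurable_EFinP; exact: measurable_inv.
  + exact: ltW.
Qed.

Lemma Omega1_logsin_le (k delta : R) : 0 < k ->
  (forall x, 0 <= x <= 1 ->
    k * x <= `|sin (pi * x)| \/ k * (1 - x) <= `|sin (pi * x)|) ->
  0 < delta -> delta <= 1 -> pi / k * delta < 1 ->
  (Omega1 (@logsin R) delta <=
   (4 * (4 * (pi / k * delta) - pi / k * delta * ln (pi / k * delta)))%:E)%E.
Proof.
move=> k0 sin_ge d0 d1; set A := pi / k * delta => A1.
have A0 : 0 < A by rewrite mulr_gt0// divr_gt0// pi_gt0.
have pd0 : 0 <= pi * delta by rewrite mulr_ge0 ?pi_ge0// ltW.
pose G (x : R) := ln (1 + pi * delta / `|sin (pi * x)|).
pose h (x : R) := ln (1 + A / `|x|).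
have G0 x : 0 <= G x by rewrite ln_ge0// lerDl divr_ge0.
have h0 x : 0 <= h x by rewrite ln_ge0// lerDl divr_ge0// ltW.
have mh : measurable_fun setT h.
  apply: (measurableT_comp (@measurable_ln R)).
  apply: measurable_funD => //; apply: measurable_funM => //.
  exact: (measurableT_comp (@measurable_inv R) (@normr_measurable R setT)).
have mG : measurable_fun setT G.
  apply: (measurableT_comp (@measurable_ln R)).
  apply: measurable_funD => //; apply: measurable_funM => //.
  apply: (measurableT_comp (@measurable_inv R)).
  apply: measurableT_comp; first exact: normr_measurable.
  apply: continuous_measurable_fun => x.
  apply: continuous_comp; last exact: continuous_sin.
  exact: mulrl_continuous.
have G1 x : G (x + 1) = G x by rewrite /G -(sin_pi_intDr x 1).
have mGd : measurable_fun setT (fun x : R => G (x + delta)).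
  by apply: measurableT_comp => //; exact: measurable_funD.
have intG : (\int[@mu R]_(x in `[0%R, 1%R[) (G x)%:E <=
    (2 * (4 * A - A * ln A))%:E)%E.
  apply: (@le_trans _ _ (\int[@mu R]_(x in `[0%R, 1%R[) (h x + h (1 - x)%R)%:E)%E).
    have mhh : measurable_fun setT (fun x : R => h x + h (1 - x)).
      apply: measurable_funD => //.
      by apply: measurableT_comp => //; exact: measurable_funB.
    apply: ge0_le_integral => //=.
    - by move=> x _; rewrite lee_fin.
    - by apply/measurable_funTS/measurable_EFinP.
    - by apply/measurable_funTS/measurable_EFinP.
    - move=> x; rewrite in_itv/= lee_fin => /andP[x0 x1].
      have hk (y s : R) : 0 < s -> k * y <= s -> 0 < y ->
          ln (1 + pi * delta / s) <= h y.
        move=> s0 kys y0; rewrite ler_ln ?posrE ?ltr_wpDr ?divr_ge0 ?(ltW s0) ?(ltW A0)//.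
        rewrite lerD2l gtr0_norm// ler_pdivrMr// mulrAC ler_pdivlMr//.
        have -> : pi * delta = A * k by rewrite /A; field; rewrite gt_eqF.
        by rewrite -mulrA ler_pM2l.
      (* Where the sine vanishes, division by zero yields 0 and [G x] is [ln 1 = 0]. *)
      have [s0|s0] := eqVneq `|sin (pi * x)| 0.
        by rewrite /G s0 invr0 mulr0 addr0 ln1 addr_ge0.
      have {}s0 : 0 < `|sin (pi * x)| by rewrite lt_neqAle eq_sym s0 normr_ge0.
      have x_gt0 : 0 < x.
        rewrite lt_neqAle x0 andbT; apply/eqP => x00.
        by move: s0; rewrite -x00 mulr0 sin0 normr0 ltxx.
      have [|kx|kx] := sin_ge x.
      + by rewrite x0 ltW.
      + by rewrite -[leLHS]addr0 lerD// hk.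
      + by rewrite -[leLHS]add0r lerD// hk// subr_gt0.
  rewrite integral_co_cc; last first.
    apply/measurable_EFinP; apply: measurable_funD => //.
    by apply: measurableT_comp => //; exact: measurable_funB.
  by rewrite ge0_integral_symmetrize// EFinM lee_pmul2l//; exact: integral_ln1D_inv_le.
(* One half bounds the integral of [G (x + delta)] and the other that of [G x]; the inner 2 counts
   the two ends of the interval. *)
have -> : 4 * (4 * A - A * ln A) = 2 * (4 * A - A * ln A) + 2 * (4 * A - A * ln A).
  by ring.
have mEG : measurable_fun setT (EFin \o G) by exact/measurable_EFinP.
have mls : measurable_fun setT (fun x : R => `|logsin (x + delta) - logsin x| : R).
  apply: measurableT_comp; first exact: normr_measurable.
  apply: measurable_funB; last exact: measurable_logsin.
  apply: measurableT_comp; first exact: measurable_logsin.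
  exact: measurable_funD.
rewrite /Omega1.
apply: (@le_trans _ _ (\int[@mu R]_(x in I) ((G (x + delta)%R)%:E + (G x)%:E))%E).
  apply: ae_ge0_le_integral => //=.
  - by apply/measurable_funTS/measurable_EFinP.
  - by move=> x _; rewrite adde_ge0 ?lee_fin.
  - by apply/measurable_funTS/measurable_EFinP; exact: measurable_funD.
  (* The pointwise bound needs both sines nonzero, which holds almost everywhere. *)
  have ae1 := @ae_sin_pi_neq0 R 1 delta (oner_neq0 _).
  have ae2 := @ae_sin_pi_neq0 R 1 0 (oner_neq0 _).
  apply: (@filterS2 _ _ (ae_filter_ringOfSetsType (@mu R)) _ _ _ _ ae1 ae2) => x.
  rewrite mul1r addr0 => s0 t0 _.
  rewrite -EFinD lee_fin; apply: distr_ln_le; rewrite ?normr_gt0//.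
  apply: (le_trans (ler_dist_dist _ _)); apply: (le_trans (sinB_le _ _)).
  by rewrite -mulrBr addrC addKr ger0_norm.
rewrite ge0_integralD//=; last 4 first.
- by move=> x _; rewrite lee_fin.
- by apply/measurable_funTS/measurable_EFinP.
- by move=> x _; rewrite lee_fin.
- exact: measurable_funTS.
rewrite -!integral_co_cc//; last exact/measurable_EFinP.
rewrite EFinD; apply: leeD => //.
rewrite (@ge0_integral_periodic_translate _ (EFin \o G))//=.
- by move=> x; rewrite G1.
- by rewrite ltW.
Qed.

Lemma Omega1_logsin_ge (delta : R) : 0 < delta -> delta < 8^-1 ->
  ((cos 1 / 2 * delta * (ln 8^-1 - ln delta))%:E <= Omega1 (@logsin R) delta)%E.
Proof.
move=> d0 d8; rewrite /Omega1; have c1 := @cos1_gt0 R.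
have mls : measurable_fun setT (fun x : R => `|logsin (x + delta) - logsin x| : R).
  apply: measurableT_comp; first exact: normr_measurable.
  apply: measurable_funB; last exact: measurable_logsin.
  apply: measurableT_comp; first exact: measurable_logsin.
  exact: measurable_funD.
apply: (@le_trans _ _ (\int[@mu R]_(x in `[delta, 8^-1%R])
    (`|logsin (x + delta) - logsin x|)%:E)%E); last first.
  apply: ge0_subset_integral => //=.
  - by apply/measurable_funTS/measurable_EFinP.
  - by move=> x /=; rewrite !in_itv/=; lra.
rewrite EFinM -(integral_inv_itv d0 d8) -ge0_integralZl_EFin//=; first last.
- by rewrite mulr_ge0 ?divr_ge0 ?(ltW d0)// ltW.
- by apply/measurable_funTS/measurable_EFinP; exact: measurable_inv.
- by move=> x; rewrite in_itv/= lee_fin invr_ge0 => /andP[dx _]; lra.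
apply: ge0_le_integral => //=.
- move=> x; rewrite in_itv/= lee_fin => /andP[dx _].
  by rewrite mulr_ge0 ?invr_ge0 ?mulr_ge0 ?divr_ge0 ?(ltW d0) ?(ltW c1)//; lra.
- apply/measurable_funTS/measurable_EFinP; apply: measurable_funM => //.
  exact: measurable_inv.
- by apply/measurable_funTS/measurable_EFinP.
move=> x; rewrite in_itv/= lee_fin => /andP[dx x8].
have p0 := @pi_gt0 R; have p2 := @pi_ge2 R; have p4 := @pihalf_lt2 R.
rewrite /logsin; set b := pi * (x + delta); set a := pi * x.
have a0 : 0 < a by rewrite mulr_gt0//; lra.
have ab : a < b by rewrite ltr_pM2l//; lra.
(* Both [x] and [delta] are at most 1/8 and [pi < 4]. *)
have b1 : b <= 1 by rewrite /b; nra.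
have sa : 0 < sin a by rewrite sin_gt0_pi// a0; lra.
have sb : 0 < sin b by rewrite sin_gt0_pi//; lra.
rewrite (gtr0_norm sa) (gtr0_norm sb).
have sB := sinB_ge (ltW a0) (ltW ab) b1.
(* Here [delta <= x] enters: [sin b <= b <= 2 a]. *)
have sb_le : sin b <= 2 * a.
  have := sinB_le b 0; rewrite sin0 !subr0 !ger0_norm; [|lra..].
  move=> /le_trans; apply; rewrite /a /b; nra.
(* So [ln (sin b) - ln (sin a)] is at least [(sin b - sin a) / sin b], whose numerator is at least
   [cos 1 * pi * delta] and whose denominator is at most [2 pi x]. *)
have h1 : ln (sin a / sin b) <= sin a / sin b - 1.
  have -> : sin a / sin b = 1 + (sin a / sin b - 1) by ring.
  rewrite [leRHS]addrC addKr; apply: le_ln1Dx.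
  have : 0 < sin a / sin b by rewrite divr_gt0.
  lra.
have h2 : cos 1 / 2 * delta * x^-1 <= 1 - sin a / sin b.
  have -> : 1 - sin a / sin b = (sin b - sin a) / sin b.
    by field; rewrite gt_eqF.
  have x0 : 0 < x by lra.
  rewrite ler_pdivlMr// mulrAC ler_pdivrMr//.
  have ba : b - a = pi * delta by rewrite /a /b; ring.
  rewrite ba in sB.
  have : cos 1 / 2 * delta * sin b <= cos 1 / 2 * delta * (2 * a).
    by rewrite ler_wpM2l// mulr_ge0 ?divr_ge0// ltW.
  have := ler_wpM2r (ltW x0) sB.
  by move=> h /le_trans; apply; apply: le_trans h; rewrite /a; nra.
apply: le_trans (ler_norm _).
by apply: (le_trans h2); rewrite ln_div ?posrE// in h1; lra.
Qed.

End modulus.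

(** * Correlations of dilates *)

Section correlation.
Variable R : realType.
Implicit Types (f g : R -> R) (x : R).
Local Notation J := (`[(0 : R), 1[%classic).

Lemma integrable_mul f g : measurable_fun setT f -> measurable_fun setT g ->
  (\int[@mu R]_(x in J) (f x ^+ 2)%:E < +oo)%E ->
  (\int[@mu R]_(x in J) (g x ^+ 2)%:E < +oo)%E ->
  (@mu R).-integrable J (fun x : R => (f x * g x)%:E).
Proof.
move=> mf mg f2 g2.
have m2 (h : R -> R) : measurable_fun setT h ->
    measurable_fun J (fun x : R => (h x ^+ 2)%:E : \bar R).
  by move=> mh; apply/measurable_funTS/measurable_EFinP/measurable_funX.
have int2 (h : R -> R) : measurable_fun setT h ->
    (\int[@mu R]_(x in J) (h x ^+ 2)%:E < +oo)%E ->
    (@mu R).-integrable J (fun x : R => (h x ^+ 2)%:E).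
  move=> mh h2; apply/integrableP; split; first exact: m2.
  by under eq_integral do rewrite gee0_abs ?lee_fin ?sqr_ge0//.
apply: (@le_integrable _ (measurableTypeR R) R (@mu R) J _ _
    (fun x => (f x ^+ 2)%:E + (g x ^+ 2)%:E)%E) => //.
- by apply/measurable_funTS/measurable_EFinP/measurable_funM.
- move=> x _; rewrite /= lee_fin.
  rewrite (ger0_norm (addr_ge0 (sqr_ge0 _) (sqr_ge0 _))) normrM.
  rewrite -[in leRHS](real_normK (num_real (f x))).
  rewrite -[in leRHS](real_normK (num_real (g x))).
  have := sqr_ge0 (`|f x| - `|g x|); have := normr_ge0 (f x).
  by have := normr_ge0 (g x); nra.
- by apply: integrableD => //; exact: int2.
Qed.

Lemma clogsin_dilate_sqr (a : nat) : (0 < a)%N ->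
  (\int[@mu R]_(x in J) (clogsin (a%:R * x) ^+ 2)%:E =
   \int[@mu R]_(x in J) (clogsin x ^+ 2)%:E)%E.
Proof.
move=> a0.
rewrite (@ge0_integral_periodic_dilate _ (fun x : R => (clogsin x ^+ 2)%:E))//.
- by apply/measurable_EFinP/measurable_funX; exact: measurable_clogsin.
- by move=> x; rewrite lee_fin sqr_ge0.
- by move=> x; rewrite clogsinD1.
Qed.

Lemma measurable_dilate f (a : R) : measurable_fun setT f ->
  measurable_fun setT (fun x : R => f (a * x)).
Proof. by move=> mf; apply: measurableT_comp => //; exact: measurable_funM. Qed.

Lemma integrable_translate f (c : R) : 0 <= c <= 1 -> measurable_fun setT f ->
  (forall x, f (x + 1) = f x) ->
  (@mu R).-integrable J (EFin \o f) ->
  (@mu R).-integrable J (fun x : R => (f (x + c))%:E).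
Proof.
move=> c01 mf f1 /integrableP[_ fi]; apply/integrableP; split.
  apply/measurable_funTS/measurable_EFinP.
  by apply: measurableT_comp => //; exact: measurable_funD.
have -> : (\int[@mu R]_(x in J) `|(f (x + c)%R)%:E| =
    \int[@mu R]_(x in J) `|(f x)%:E|)%E; last exact: fi.
apply: (@ge0_integral_periodic_translate _ (fun x : R => `|(f x)%:E|%E)) => //.
- by apply: measurableT_comp => //; exact/measurable_EFinP.
- by move=> x; rewrite f1.
Qed.

(** Translating [x] by [j / a] leaves [g (a x)] fixed, while the corresponding values of [clogsin]
    sum to [clogsin (a b x)]. Hence [a] times the left integral is that of
    [g (a x) clogsin (b a x)], and the dilation by [a] can be removed. *)
Lemma correlation_reduce g (a b : nat) : (0 < a)%N -> (0 < b)%N ->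
  coprime a b -> measurable_fun setT g -> (forall x, g (x + 1) = g x) ->
  (\int[@mu R]_(x in J) (g x ^+ 2)%:E < +oo)%E ->
  (\int[@mu R]_(x in J) (g (a%:R * x) * clogsin (b%:R * x))%:E =
   (a%:R^-1)%:E * \int[@mu R]_(x in J) (g x * clogsin (b%:R * x))%:E)%E.
Proof.
move=> a0 b0 ab mg g1 g2; have aR : (0 : R) < a%:R by rewrite ltr0n.
have gn x (n : nat) : g (x + n%:R) = g x.
  by elim: n => [|n <-]; rewrite ?addr0// -natr1 addrA g1.
pose H x := g (a%:R * x) * clogsin (b%:R * x).
have mH : measurable_fun setT H.
  by apply: measurable_funM; apply: measurable_dilate => //; exact: measurable_clogsin.
have H1 x : H (x + 1) = H x.
  by rewrite /H !(mulrDr _ x) !mulr1 gn clogsinDnat.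
have gd2 : (\int[@mu R]_(x in J) (g (a%:R * x) ^+ 2)%:E < +oo)%E.
  rewrite (@ge0_integral_periodic_dilate _ (fun x : R => (g x ^+ 2)%:E))//.
  - by apply/measurable_EFinP/measurable_funX.
  - by move=> x; rewrite lee_fin sqr_ge0.
  - by move=> x; rewrite g1.
have iH : (@mu R).-integrable J (EFin \o H).
  apply: integrable_mul => //; first exact: measurable_dilate.
    by apply: measurable_dilate; exact: measurable_clogsin.
  by rewrite clogsin_dilate_sqr//; exact: clogsin_sqr_integrable.
have c01 (j : 'I_a) : 0 <= (j%:R / a%:R : R) <= 1.
  apply/andP; split; first by rewrite divr_ge0.
  by rewrite ler_pdivrMr// mul1r ler_nat ltnW.
have sumI : (a%:R%:E * \int[@mu R]_(x in J) (H x)%:E =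
    \sum_(j < a) \int[@mu R]_(x in J) (H (x + j%:R / a%:R)%R)%:E)%E.
  transitivity (\sum_(j < a) 1%:E * \int[@mu R]_(x in J) (H x)%:E)%E.
    by rewrite -ge0_sume_distrl// sumEFin sumr_const card_ord.
  apply: eq_bigr => j _; rewrite mul1e.
  rewrite (@integral_periodic_translate _ (EFin \o H) _ _ _ (c01 j))//.
    exact/measurable_EFinP.
  by move=> x /=; rewrite H1.
have -> : (\int[@mu R]_(x in J) (g x * clogsin (b%:R * x))%:E =
    a%:R%:E * \int[@mu R]_(x in J) (H x)%:E)%E; last first.
  by rewrite muleA -EFinM mulVf ?gt_eqF// mul1e.
rewrite sumI -integral_sum//=; last first.
  by move=> j; apply: integrable_translate.
pose K x := g x * clogsin (b%:R * x).
have mK : measurable_fun setT K.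
  by apply: measurable_funM => //; apply: measurable_dilate; exact: measurable_clogsin.
rewrite -(@integral_periodic_dilate _ (EFin \o K) _ _ a)//=; last 2 first.
- exact/measurable_EFinP.
- by move=> x; rewrite /K g1 (mulrDr _ x) mulr1 clogsinDnat.
apply: ae_eq_integral => //.
- by apply/measurable_funTS/measurable_EFinP; exact: measurable_dilate.
- apply/measurable_funTS; apply: emeasurable_sum => j; apply/measurable_EFinP.
  by apply: measurableT_comp => //; exact: measurable_funD.
have abR : (a%:R * b%:R : R) != 0 by rewrite mulf_neq0// pnatr_eq0 -lt0n.
have ae1 := @ae_sin_pi_neq0 R (a%:R * b%:R) 0 abR.
apply: (@filterS _ _ (ae_filter_ringOfSetsType (@mu R)) _ _ _ ae1) => x.
rewrite addr0 => s0 _.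
rewrite sumEFin; congr EFin; rewrite /K /H.
have -> : b%:R * (a%:R * x) = a%:R * (b%:R * x) by ring.
rewrite -mulrA in s0; rewrite -(clogsin_shift_sum _ ab)//.
rewrite mulr_sumr; apply: eq_bigr => j _; congr (_ * _); last by rewrite mulrDr.
by rewrite mulrDr mulrCA divff ?mulr1 ?gn// gt_eqF.
Qed.

(** Two reductions: the first removes [a], the second, with the factors exchanged and the coprime
    pair [b], 1, removes [b]. *)
Lemma correlation_coprime (a b : nat) : (0 < a)%N -> (0 < b)%N -> coprime a b ->
  (\int[@mu R]_(x in J) (clogsin (a%:R * x) * clogsin (b%:R * x))%:E =
   ((a * b)%:R^-1)%:E * \int[@mu R]_(x in J) (clogsin x ^+ 2)%:E)%E.
Proof.
move=> a0 b0 ab.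
have mc := @measurable_clogsin R.
have c1 := @clogsinD1 R.
have c2 := @clogsin_sqr_integrable R.
rewrite (correlation_reduce a0 b0 ab mc c1 c2).
under eq_integral do rewrite mulrC -[X in _ * clogsin X]mul1r.
rewrite (correlation_reduce b0 (ltn0Sn 0) (coprimen1 b) mc c1 c2).
rewrite muleA -EFinM -invfM -natrM mulnC.
by under eq_integral do rewrite mul1r -expr2.
Qed.

(** The common factor [d] is a dilation of the whole integrand, which preserves the integral. *)
Lemma correlation (a b : nat) : (0 < a)%N -> (0 < b)%N ->
  (\int[@mu R]_(x in J) (clogsin (a%:R * x) * clogsin (b%:R * x))%:E =
   (((a %/ gcdn a b) * (b %/ gcdn a b))%:R^-1)%:E *
   \int[@mu R]_(x in J) (clogsin x ^+ 2)%:E)%E.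
Proof.
move=> a0 b0; set d := gcdn a b.
have d0 : (0 < d)%N by rewrite gcdn_gt0 a0.
have ad : a = (a %/ d * d)%N by rewrite divnK// dvdn_gcdl.
have bd : b = (b %/ d * d)%N by rewrite divnK// dvdn_gcdr.
have a'0 : (0 < a %/ d)%N by rewrite divn_gt0// dvdn_leq// dvdn_gcdl.
have b'0 : (0 < b %/ d)%N by rewrite divn_gt0// dvdn_leq// dvdn_gcdr.
have cop : coprime (a %/ d) (b %/ d).
  by rewrite /coprime -(eqn_pmul2r d0) muln_gcdl -ad -bd mul1n.
rewrite -(correlation_coprime a'0 b'0 cop).
pose H x := clogsin ((a %/ d)%:R * x) * clogsin ((b %/ d)%:R * x).
rewrite -(@integral_periodic_dilate _ (EFin \o H) _ _ d)//=.
- apply: eq_integral => x _; by rewrite /H !mulrA -!natrM -ad -bd.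
- apply/measurable_EFinP; apply: measurable_funM;
    by apply: measurable_dilate; exact: measurable_clogsin.
- by move=> x; rewrite /H !(mulrDr _ x) !mulr1 !clogsinDnat.
Qed.

(** Since [2^n - 1 = (2^m - 1) + 2^m (2^(n - m) - 1)] and [d] is coprime to [2^m], the gcd [d]
    divides the positive number [2^(n - m) - 1]. *)
Lemma mersenne_gcd_bound (m n : nat) : (m < n)%N ->
  (2 ^ m * gcdn (2 ^ m - 1) (2 ^ n - 1) <= 2 ^ n - 1)%N.
Proof.
move=> mn; set d := gcdn _ _.
have nE : (2 ^ n - 1 = (2 ^ m - 1) + 2 ^ m * (2 ^ (n - m) - 1))%N.
  have h1 : (0 < 2 ^ m)%N by rewrite expn_gt0.
  have -> : (2 ^ n = 2 ^ m * 2 ^ (n - m))%N by rewrite -expnD subnKC// ltnW.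
  rewrite mulnBr muln1 addnBAC// subnKC//.
  by rewrite leq_pmulr// expn_gt0.
have dvd : (d %| 2 ^ (n - m) - 1)%N.
  have : (d %| 2 ^ m * (2 ^ (n - m) - 1))%N.
    by rewrite -(@dvdn_addr (2 ^ m - 1)) -?nE ?dvdn_gcdl ?dvdn_gcdr.
  rewrite Gauss_dvdr//; apply: (@coprime_dvdl _ (2 ^ m - 1)).
    exact: dvdn_gcdl.
  by rewrite subn1 coprimePn// expn_gt0.
rewrite nE; apply: leq_trans (leq_addl _ _); rewrite leq_mul2l dvdn_leq ?orbT//.
by rewrite subn_gt0 -[X in (X < _)%N](expn0 2) ltn_exp2l// subn_gt0.
Qed.

(** After division by the gcd, the first factor is at least 1 and the second at least [2^m]. *)
Lemma correlation_mersenne (m n : nat) : (0 < m)%N -> (m < n)%N ->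
  (\int[@mu R]_(x in J)
     (clogsin ((2 ^ m - 1)%:R * x) * clogsin ((2 ^ n - 1)%:R * x))%:E <=
   (2^-1 ^+ m)%:E * \int[@mu R]_(x in J) (clogsin x ^+ 2)%:E)%E.
Proof.
move=> m0 mn.
have pos k : (0 < k)%N -> (0 < 2 ^ k - 1)%N.
  by move=> k0; rewrite subn_gt0 -[X in (X < _)%N](expn0 2) ltn_exp2l.
have a0 := pos _ m0; have b0 := pos _ (ltn_trans m0 mn).
rewrite correlation//; apply: lee_wpmul2r.
  by apply: integral_ge0 => x _; rewrite lee_fin sqr_ge0.
set d := gcdn _ _; have d0 : (0 < d)%N by rewrite gcdn_gt0 a0.
rewrite lee_fin exprVn lef_pV2 ?posrE ?exprn_gt0//.
  rewrite -natrX ler_nat; apply: leq_trans (leq_pmull _ _).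
    by rewrite leq_divRL//; exact: mersenne_gcd_bound.
  by rewrite divn_gt0// dvdn_leq// dvdn_gcdl.
rewrite ltr0n muln_gt0 !divn_gt0//.
by rewrite (dvdn_leq a0 (dvdn_gcdl _ _)) (dvdn_leq b0 (dvdn_gcdr _ _)).
Qed.

End correlation.

(** * Almost everywhere convergence *)

Section second_moment.
Variable R : realType.
Local Notation J := (`[(0 : R), 1[%classic).

(** The shift in [i.+1] lets the exponent run from 1 to [N]. *)
Definition mersenne_sum (N : nat) (x : R) : R :=
  \sum_(i < N) clogsin ((2 ^ i.+1 - 1)%:R * x).

Lemma measurable_mersenne_sum N : measurable_fun setT (mersenne_sum N).
Proof.
apply: measurable_sum => i; apply: measurable_dilate.
exact: measurable_clogsin.
Qed.

Lemma sum_half_le1 (N : nat) : \sum_(i < N) (2^-1 : R) ^+ i.+1 <= 1.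
Proof.
suff -> : \sum_(i < N) (2^-1 : R) ^+ i.+1 = 1 - 2^-1 ^+ N.
  by rewrite gerBl exprn_ge0.
elim: N => [|N IH]; first by rewrite big_ord0 expr0 subrr.
by rewrite big_ord_recr/= IH !exprS; field.
Qed.

Lemma mersenne_second_moment (N : nat) :
  (\int[@mu R]_(x in J) (mersenne_sum N x ^+ 2)%:E <=
   (3 * N%:R)%:E * \int[@mu R]_(x in J) (clogsin x ^+ 2)%:E)%E.
Proof.
set V := (\int[@mu R]_(x in J) (clogsin x ^+ 2)%:E)%E.
have V0 : (0 <= V)%E by apply: integral_ge0 => x _; rewrite lee_fin sqr_ge0.
have Vfin : V \is a fin_num by rewrite ge0_fin_numE//; exact: clogsin_sqr_integrable.
pose A i := ((2 ^ i.+1 - 1)%N)%:R : R.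
have A0 i : (0 < 2 ^ i.+1 - 1)%N.
  by rewrite subn_gt0 -[X in (X < _)%N](expn0 2) ltn_exp2l.
have mA i : measurable_fun setT (fun x : R => clogsin (A i * x)).
  by apply: measurable_dilate; exact: measurable_clogsin.
have intA i j : (@mu R).-integrable J
    (fun x => (clogsin (A i * x) * clogsin (A j * x))%:E).
  apply: integrable_mul => //; rewrite clogsin_dilate_sqr//;
    exact: clogsin_sqr_integrable.
(* One bound for all pairs: the first two terms cover the two orders of [i] and [j], the third the
   diagonal. Each sums to at most [N] over the square, whence the factor 3. *)
have bound (i j : nat) :
    (\int[@mu R]_(x in J) (clogsin (A i * x) * clogsin (A j * x))%:E <=
     (2^-1 ^+ i.+1 + 2^-1 ^+ j.+1 + (i == j)%:R)%:E * V)%E.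
  have p k : 0 <= 2^-1 ^+ k :> R by rewrite exprn_ge0.
  case: (ltngtP i j) => ij.
  - apply: le_trans (correlation_mersenne R (ltn0Sn i) _) _; first by rewrite ltnS.
    by apply: lee_wpmul2r => //; rewrite lee_fin addr0 lerDl.
  - under eq_integral do rewrite mulrC.
    apply: le_trans (correlation_mersenne R (ltn0Sn j) _) _; first by rewrite ltnS.
    by apply: lee_wpmul2r => //; rewrite lee_fin addr0 lerDr.
  - rewrite -ij; under eq_integral do rewrite -expr2.
    rewrite clogsin_dilate_sqr// -[leLHS]mul1e; apply: lee_wpmul2r => //.
    by rewrite lee_fin lerDr addr_ge0.
have -> : (\int[@mu R]_(x in J) (mersenne_sum N x ^+ 2)%:E =
   \sum_(i < N) \sum_(j < N)
     \int[@mu R]_(x in J) (clogsin (A i * x) * clogsin (A j * x))%:E)%E.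
  transitivity (\int[@mu R]_(x in J) (\sum_(i < N) \sum_(j < N)
      (clogsin (A i * x)%R * clogsin (A j * x)%R)%:E))%E.
    apply: eq_integral => x _; rewrite /mersenne_sum expr2 big_distrlr/=.
    by rewrite -sumEFin; apply: eq_bigr => i _; rewrite -sumEFin.
  rewrite integral_sum//.
    by apply: eq_bigr => i _; rewrite integral_sum.
  by move=> i; apply: integrable_sum => // j _; exact: intA.
apply: (@le_trans _ _ (\sum_(i < N) \sum_(j < N)
    (2^-1 ^+ i.+1 + 2^-1 ^+ j.+1 + (i == j :> nat)%:R)%R%:E * V)%E).
  by apply: lee_sum => i _; apply: lee_sum => j _; exact: bound.
rewrite -(fineK Vfin); set v := fine V.
have v0 : 0 <= v by rewrite fine_ge0.
under eq_bigr => i _ do under eq_bigr => j _ do rewrite -EFinM.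
under eq_bigr => i _ do rewrite sumEFin -mulr_suml.
rewrite sumEFin -mulr_suml -EFinM lee_fin ler_wpM2r//.
under eq_bigr do rewrite !big_split/=.
rewrite !big_split/=.
have h1 : \sum_(i < N) \sum_(j < N) (2^-1 : R) ^+ i.+1 <= N%:R.
  rewrite exchange_big/=; apply: (@le_trans _ _ (\sum_(i < N) 1)).
    by apply: ler_sum => j _; exact: sum_half_le1.
  by rewrite sumr_const card_ord.
have h2 : \sum_(i < N) \sum_(j < N) (2^-1 : R) ^+ j.+1 <= N%:R.
  by rewrite exchange_big.
have h3 : \sum_(i < N) \sum_(j < N) ((i == j :> nat)%:R : R) = N%:R.
  rewrite (eq_bigr (fun=> 1)) => [|i _]; first by rewrite sumr_const card_ord.
  rewrite (bigD1 i)//= eqxx big1 ?addr0// => j ji.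
  by rewrite eq_sym (inj_eq val_inj) (negbTE ji).
rewrite h3; lra.
Qed.

(** Telescoping with [1 / (k + 1)^2 <= 1 / k - 1 / (k + 1)]. *)
Lemma sum_inv_sqr_le2 (N : nat) : \sum_(i < N) (i.+1%:R ^+ 2)^-1 <= 2 :> R.
Proof.
case: N => [|N]; first by rewrite big_ord0.
suff : \sum_(i < N.+1) (i.+1%:R ^+ 2)^-1 <= 2 - (N.+1%:R)^-1 :> R.
  by move=> /le_trans; apply; rewrite gerBl invr_ge0.
elim: N => [|N IH].
  by rewrite big_ord_recr big_ord0/= add0r expr1n invr1; lra.
rewrite big_ord_recr/=; apply: (le_trans (lerD IH (lexx _))).
rewrite -(natr1 N.+1); set k : R := N.+1%:R; have k0 : 0 < k by rewrite ltr0n.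
have : ((k + 1) ^+ 2)^-1 <= (k * (k + 1))^-1.
  by rewrite lef_pV2 ?posrE ?exprn_gt0 ?mulr_gt0//; nra.
have -> : (k * (k + 1))^-1 = k^-1 - (k + 1)^-1.
  by field; rewrite !gt_eqF// ltr_wpDr.
by move: (k^-1) ((k + 1)^-1) ((k + 1) ^- 2) => u v w; lra.
Qed.

(** The series of squared averages has a finite integral, so it converges almost everywhere and its
    terms tend to 0. *)
Lemma ae_mersenne_average : {ae @mu R, forall x, x \in J ->
  (fun k : nat => mersenne_sum (k.+1 ^ 2) x / (k.+1 ^ 2)%:R) @ \oo --> (0 : R)}.
Proof.
set V := (\int[@mu R]_(x in J) (clogsin x ^+ 2)%:E)%E.
pose Z (k : nat) (x : R) := mersenne_sum (k.+1 ^ 2) x / (k.+1 ^ 2)%:R.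
have mZ k : measurable_fun setT (Z k).
  by apply: measurable_funM => //; exact: measurable_mersenne_sum.
have mZ2 k D : measurable_fun D (fun x => (Z k x ^+ 2)%:E).
  by apply/measurable_funTS/measurable_EFinP/measurable_funX.
have Z2 k : (\int[@mu R]_(x in J) (Z k x ^+ 2)%:E <=
    (3 * (k.+1%:R ^+ 2)^-1)%:E * V)%E.
  have k0 : (0 : R) < (k.+1 ^ 2)%:R by rewrite ltr0n expn_gt0.
  under eq_integral do rewrite /Z exprMn mulrC EFinM.
  rewrite ge0_integralZl_EFin//=.
  - apply: (@le_trans _ _ ((((k.+1 ^ 2)%:R^-1) ^+ 2)%:E *
      ((3 * (k.+1 ^ 2)%:R)%:E * V))%E).
      by apply: lee_wpmul2l; rewrite ?lee_fin ?sqr_ge0//; exact: mersenne_second_moment.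
    rewrite muleA -EFinM -natrX le_eqVlt; apply/orP; left; apply/eqP.
    by congr (_%:E * _)%E; field; rewrite gt_eqF.
  - by move=> x _; rewrite lee_fin sqr_ge0.
  - apply/measurable_funTS/measurable_EFinP/measurable_funX.
    exact: measurable_mersenne_sum.
have V0 : (0 <= V)%E by apply: integral_ge0 => x _; rewrite lee_fin sqr_ge0.
have Vfin : V \is a fin_num by rewrite ge0_fin_numE//; exact: clogsin_sqr_integrable.
pose S (x : R) : \bar R := (\sum_(0 <= k <oo) (Z k x ^+ 2)%:E)%E.
have mS : measurable_fun J S.
  by apply: ge0_emeasurable_sum => [k x _ _|k _]; [rewrite lee_fin sqr_ge0|].
have S0 x : (0 <= S x)%E.
  by apply: nneseries_ge0 => k _ _; rewrite lee_fin sqr_ge0.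
have S_lty : (\int[@mu R]_(x in J) S x < +oo)%E.
  rewrite /S integral_nneseries//; last 2 first.
    by move=> k; exact: mZ2.
    by move=> k x _; rewrite lee_fin sqr_ge0.
  (* 6 is the second moment factor 3 times the bound 2 on the inverse squares. *)
  apply: (@le_lt_trans _ _ ((6 * fine V)%:E)); last exact: ltry.
  apply: lime_le.
    apply: is_cvg_nneseries => k _ _; apply: integral_ge0 => x _.
    by rewrite lee_fin sqr_ge0.
  apply: nearW => n; rewrite big_mkord.
  apply: (@le_trans _ _ (\sum_(k < n) (3 * (k.+1%:R ^+ 2)^-1 * fine V)%:E)%E).
    by apply: lee_sum => k _; rewrite EFinM fineK.
  rewrite sumEFin lee_fin -mulr_suml -mulr_sumr ler_wpM2r ?fine_ge0//.
  have := sum_inv_sqr_le2 n; lra.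
have iS : (@mu R).-integrable J S.
  apply/integrableP; split => //.
  have -> : (\int[@mu R]_(x in J) `|S x| = \int[@mu R]_(x in J) S x)%E.
    by apply: eq_integral => x _; rewrite gee0_abs.
  exact: S_lty.
have ae1 := @integrable_ae _ (measurableTypeR R) R (@mu R) J
  (measurable_itv _) S iS.
apply: (@filterS _ _ (ae_filter_ringOfSetsType (@mu R)) _ _ _ ae1) => x.
move=> /[swap] /[!inE] xJ /(_ xJ) Sfin.
have /cvg_series_cvg_0 Z0 : cvgn (series (fun k => Z k x ^+ 2)).
  apply: nnseries_is_cvg => [k|]; first exact: sqr_ge0.
  by rewrite -ge0_fin_numE//; exact: S0.
apply/norm_cvg0P.
have -> : (fun k => `|Z k x|) = (fun k => Num.sqrt (Z k x ^+ 2)).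
  by apply/funext => k; rewrite sqrtr_sqr.
rewrite -(@sqrtr0 R).
exact: (cvg_comp _ _ Z0 (@sqrt_continuous R 0)).
Qed.

End second_moment.

(* Monotone partial sums lose only the factor ((k + 2) / (k + 1))^2 between
   consecutive squares, and this factor tends to 1. *)
Lemma cvg_average_squares (R : realType) (u : nat -> R) (l : R) :
  (forall i, 0 <= u i) ->
  (fun k => (\sum_(i < k.+1 ^ 2) u i) / (k.+1 ^ 2)%:R) @ \oo --> l ->
  (fun N => (\sum_(i < N) u i) / N%:R) @ \oo --> l.
Proof.
move=> u0 cvg_sq; pose T N := \sum_(i < N) u i.
have T0 N : 0 <= T N by apply: sumr_ge0.
have T_nd m n : (m <= n)%N -> T m <= T n.
  move=> mn; rewrite /T -(subnKC mn) big_split_ord/= lerDl.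
  by apply: sumr_ge0.
pose a k := T (k.+1 ^ 2)%N / (k.+1 ^ 2)%:R.
(* This is [(k + 1) / (k + 2)], written so that its limit 1 is immediate. *)
pose r (k : nat) : R := 1 - harmonic k.+1.
have rE k : r k = k.+1%:R / k.+2%:R.
  have k2 : k.+2%:R != 0 :> R by rewrite pnatr_eq0.
  apply: (mulIf k2); rewrite /r /harmonic/= mulrBl mulVf// divfK// mul1r.
  by rewrite -(natr1 k.+1) addrK.
have r_gt0 k : 0 < r k by rewrite rE divr_gt0.
have r_cvg : r @ \oo --> (1 : R).
  rewrite -[X in _ --> X]subr0; apply: cvgB; first exact: cvg_cst.
  have := @cvg_harmonic R; rewrite -(cvg_shiftS (@harmonic R)); exact.
have a_cvg : a @ \oo --> l by [].
have aS_cvg : (fun k => a k.+1) @ \oo --> l by rewrite (cvg_shiftS a).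
have lo_cvg : (fun k => a k * (r k * r k)) @ \oo --> l.
  by rewrite -[X in _ --> X]mulr1 -[X in _ * X]mulr1; apply: cvgM => //; exact: cvgM.
have hi_cvg : (fun k => a k.+1 * ((r k)^-1 * (r k)^-1)) @ \oo --> l.
  have rV : (fun k => (r k)^-1) @ \oo --> (1 : R).
    by rewrite -[X in _ --> X]invr1; apply: cvgV => //; exact: oner_neq0.
  by rewrite -[X in _ --> X]mulr1 -[X in _ * X]mulr1; apply: cvgM => //; exact: cvgM.
have sandwich (N k : nat) : (k.+1 ^ 2 <= N)%N -> (N < k.+2 ^ 2)%N ->
    a k * (r k * r k) <= T N / N%:R <= a k.+1 * ((r k)^-1 * (r k)^-1).
  move=> kN Nk; have N0 : (0 : R) < N%:R.
    by rewrite ltr0n; apply: leq_trans kN; rewrite expn_gt0.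
  rewrite /a rE !natrX; set p : R := k.+1%:R; set q : R := k.+2%:R.
  have p0 : 0 < p by rewrite ltr0n.
  have q0 : 0 < q by rewrite ltr0n.
  have pN : p ^+ 2 <= N%:R by rewrite -natrX ler_nat.
  have Nq : N%:R <= q ^+ 2 by rewrite -natrX ler_nat ltnW.
  have -> : T (k.+1 ^ 2)%N / p ^+ 2 * (p / q * (p / q)) = T (k.+1 ^ 2)%N / q ^+ 2.
    by field; rewrite !gt_eqF.
  have -> : T (k.+2 ^ 2)%N / q ^+ 2 * ((p / q)^-1 * (p / q)^-1) =
      T (k.+2 ^ 2)%N / p ^+ 2.
    by field; rewrite !gt_eqF.
  apply/andP; split.
  - apply: (ler_pM (T0 _) _ (T_nd _ _ kN)); first by rewrite invr_ge0 exprn_ge0 ?ltW.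
    by rewrite lef_pV2 ?posrE ?exprn_gt0.
  - apply: (ler_pM (T0 _) _ (T_nd _ _ (ltnW Nk))); first by rewrite invr_ge0 ltW.
    by rewrite lef_pV2 ?posrE ?exprn_gt0.
have sqrt_ex (N : nat) : (0 < N)%N ->
    exists k : nat, (k.+1 ^ 2 <= N < k.+2 ^ 2)%N.
  elim: N => // N IH _; have [->|N0] := posnP N; first by exists 0%N.
  have [k /andP[kN Nk]] := IH N0.
  have [h|h] := ltnP N.+1 (k.+2 ^ 2)%N; first by exists k; rewrite h leqW.
  exists k.+1; rewrite h/=; apply: leq_ltn_trans Nk _.
  by rewrite ltn_exp2r.
apply/cvgrPdist_le => /= e e0.
have /cvgrPdist_le/(_ e e0)[K1 _ hK1] := lo_cvg.
have /cvgrPdist_le/(_ e e0)[K2 _ hK2] := hi_cvg.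
(* From this index on, the [k] with [k.+1 ^ 2 <= N < k.+2 ^ 2] is at least [maxn K1 K2]. *)
exists ((maxn K1 K2).+1 ^ 2)%N => //= N hN.
have [|k /andP[kN Nk]] := sqrt_ex N.
  by apply: leq_trans hN; rewrite expn_gt0.
have Kk : (maxn K1 K2 <= k)%N.
  by have := leq_ltn_trans hN Nk; rewrite ltn_exp2r// !ltnS.
have := hK1 k (leq_trans (leq_maxl _ _) Kk).
have := hK2 k (leq_trans (leq_maxr _ _) Kk).
have /andP[] := sandwich N k kN Nk; rewrite /= !ler_norml -/(T N).
by move=> h1 h2 /andP[h3 h4] /andP[h5 h6]; apply/andP; split; lra.
Qed.

(** The line is a countable union of integer translates of [[0, 1[], and translation preserves null
    sets. *)
Lemma ae_periodic (R : realType) (P : R -> Prop) :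
  (forall x (k : int), P x -> P (x + k%:~R)) ->
  {ae @mu R, forall x, x \in (`[(0 : R), 1[%classic) -> P x} ->
  {ae @mu R, forall x, P x}.
Proof.
move=> Pshift [N [mN N0 subN]].
have ae_shift (k : int) : {ae @mu R, forall x,
    x - k%:~R \in (`[(0 : R), 1[%classic) -> P x}.
  pose phi (x : measurableTypeR R) : measurableTypeR R := 1 * x + (- k%:~R).
  have mphi : measurable_fun setT phi.
    by apply: measurable_funD => //; exact: measurable_funM.
  exists (phi @^-1` N); split.
  - by rewrite -[X in measurable X]setTI; exact: mphi.
  - have := pushforward_lebesgue_affine (- k%:~R) (@ltr01 R) mN.
    by rewrite N0 mule0.
  - move=> x /= nP; apply: subN; rewrite /phi mul1r => /= h; apply: nP => xJ.
    by rewrite -[x](subrK k%:~R); apply: Pshift; exact: h.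
(* The translates are enumerated by [nat]; the point [x] lies in the one given by its floor. *)
have := ae_foralln (fun n : nat => ae_shift (odflt 0 (unpickle n))).
apply: (@filterS _ _ (ae_filter_ringOfSetsType (@mu R))) => x.
move=> /(_ (pickle (Num.floor x))); rewrite pickleK/=; apply.
rewrite inE/= in_itv/= subr_ge0 floor_le_tmp/= ltrBlDr addrC -intrD1.
exact: floorD1_gt.
Qed.

Lemma ae_logsin_average (R : realType) : {ae @mu R, forall xi : R,
  (fun N : nat => N%:R^-1 *
     \sum_(1 <= n < N.+1) ln `|sin (pi * (2 ^+ n * xi - xi))|)
    @ \oo --> - ln (2 : R)}.
Proof.
(* The sign makes the terms nonnegative, as [cvg_average_squares] requires; each is [ln 2] minus the
   matching [clogsin] value. *)
pose u (xi : R) (i : nat) := - logsin ((2 ^ i.+1 - 1)%:R * xi).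
pose A (xi : R) N := (\sum_(i < N) u xi i) / N%:R.
have AE xi : (fun N : nat => N%:R^-1 *
     \sum_(1 <= n < N.+1) ln `|sin (pi * (2 ^+ n * xi - xi))|) =
    (fun N => - A xi N).
  apply/funext => N; rewrite /A /u sumrN mulNr opprK mulrC; congr (_ * _).
  rewrite big_add1 big_mkord; apply: eq_bigr => i _; rewrite /logsin.
  by rewrite natrB ?expn_gt0// natrX mulrBl mul1r.
suff : {ae @mu R, forall xi : R, A xi @ \oo --> ln (2 : R)}.
  apply: (@filterS _ _ (ae_filter_ringOfSetsType (@mu R))) => xi Axi.
  by rewrite AE; exact: cvgN.
apply: ae_periodic => [xi k|].
  suff -> : A (xi + k%:~R) = A xi by [].
  apply/funext => N; congr (_ / _); apply: eq_bigr => i _; rewrite /u.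
  by rewrite mulrDr pmulrn -intrM logsinDint.
apply: (@filterS _ _ (ae_filter_ringOfSetsType (@mu R)) _ _ _ (@ae_mersenne_average R)).
move=> xi /[apply] M0; apply: cvg_average_squares.
  by move=> i; rewrite oppr_ge0 logsin_le0.
rewrite -[X in _ --> X]subr0.
rewrite [X in X @ _](_ : _ = (fun k =>
    ln 2 - mersenne_sum (k.+1 ^ 2) xi / (k.+1 ^ 2)%:R)).
  by apply: cvgB => //; exact: cvg_cst.
apply/funext => k; rewrite /mersenne_sum /clogsin big_split/= sumr_const card_ord.
rewrite /u sumrN mulNr -(mulr_natr (ln 2)) mulrDl mulfK ?pnatr_eq0 -?lt0n ?expn_gt0//.
by rewrite opprD addrCA subrr addr0.
Qed.

(** * Explicit constants for the modulus, and the theorem *)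

Lemma Omega1_logsin_bounds (R : realType) :
  exists C1 C2 : R, 0 < C1 /\ C1 < C2 /\
     exists delta0 : R, 0 < delta0 /\
       forall delta : R, 0 < delta -> delta < delta0 ->
         ((C1 * delta * `|ln delta|)%:E <= Omega1 (@logsin R) delta)%E /\
         (Omega1 (@logsin R) delta <= (C2 * delta * `|ln delta|)%:E)%E.
Proof.
have [k k0 sin_ge] := sin_pi_ge R.
have c0 := @cos1_gt0 R; pose K := pi / k.
have K0 : 0 < K by rewrite divr_gt0// pi_gt0.
have l8 : 0 <= ln 8 :> R by rewrite ln_ge0// ler1n.
have lK := ler_norm (- ln K); rewrite normrN in lK.
have lK0 := normr_ge0 (ln K).
(* [C1] is half the constant of the lower estimate; the other half absorbs [ln 8]. For [C], the
   upper estimate is [4 K d (4 - ln K - ln d)], and [- ln d >= 1] bounds the bracket by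
   [(5 + |ln K|) (- ln d)]. *)
pose C1 : R := cos 1 / 4; pose C := 4 * K * (5 + `|ln K|).
have C10 : 0 < C1 by rewrite divr_gt0.
have C0 : 0 < C by apply: mulr_gt0; [exact: mulr_gt0|lra].
(* Adding [C1] forces the strict inequality between the constants. *)
exists C1, (C + C1); split => //; split; first by rewrite ltrDr.
(* The exponential gives [- ln d > 1 + 2 ln 8], [K^-1] gives [K d < 1] for the upper estimate, and
   [8^-1] is the range of the lower one. *)
exists (Num.min (expR (- (1 + 2 * ln 8))) (Num.min K^-1 8^-1)).
split; first by rewrite !lt_min expR_gt0 !invr_gt0 K0/=.
move=> d d0; rewrite !lt_min => /and3P[de dK d8].
have ld : ln d < - (1 + 2 * ln 8).
  by rewrite -[ltRHS]expRK ltr_ln ?posrE// expR_gt0.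
have ldN : `|ln d| = - ln d by rewrite ltr0_norm//; lra.
rewrite ldN; split.
  apply: le_trans (Omega1_logsin_ge d0 d8); rewrite lee_fin lnV ?posrE//.
  have : 0 <= cos 1 * d * (- ln d - 2 * ln 8).
    by rewrite mulr_ge0//; [rewrite mulr_ge0// ltW|lra].
  by rewrite /C1; lra.
have Kd : K * d < 1 by rewrite mulrC -ltr_pdivlMr// mul1r.
have d1 : d <= 1 by lra.
apply: (le_trans (Omega1_logsin_le k0 sin_ge d0 d1 Kd)).
rewrite lee_fin -/K lnM ?posrE//.
have h1 : 0 <= K * d * ((4 + `|ln K|) * - ln d - (4 - ln K)).
  rewrite mulr_ge0//; first by rewrite mulr_ge0// ltW.
  nra.
have h2 : 0 <= C1 * d * - ln d.
  by rewrite mulr_ge0//; [rewrite mulr_ge0// ltW|lra].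
by rewrite /C; lra.
Qed.

Unset Implicit Arguments.

Theorem theorem3p2 (R : realType) :
  (exists C1 C2 : R, 0 < C1 /\ C1 < C2 /\
     exists delta0 : R, 0 < delta0 /\
       forall delta : R, 0 < delta -> delta < delta0 ->
         ((C1 * delta * `|ln delta|)%:E <= Omega1 (@logsin R) delta)%E /\
         (Omega1 (@logsin R) delta <= (C2 * delta * `|ln delta|)%:E)%E) /\
  {ae @lebesgue_measure R, forall xi : R,
     (fun N : nat => N%:R^-1 *
        \sum_(1 <= n < N.+1) ln `|sin (pi * (2 ^+ n * xi - xi))|)
       @ \oo --> - ln (2 : R)}.
Proof. by split; [exact: Omega1_logsin_bounds|exact: ae_logsin_average]. Qed.
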